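(* Let $d = 1/2$. There exists a unique function $\varphi \in C^3(0,d)\cap C^1[0,d]$ with $\varphi(\eta)>0$ for $0<\eta<d$ such that $$\varphi(\eta)\,\varphi'''(\eta) = 1 \quad \text{for } 0<\eta<d,\qquad \varphi(0)=\varphi(d)=0,\qquad \varphi'(0)=1 .$$
   Context: All functions are real-valued. $C^3(0,d)\cap C^1[0,d]$ denotes the functions that are three times continuously differentiable on the open interval $(0,d)$ and continuously differentiable up to the endpoints of $[0,d]$ (with one-sided derivatives at the endpoints). Uniqueness is within this class of functions positive on $(0,d)$. *)

(* Defs.v *)
From Stdlib Require Import Reals.
From Coquelicot Require Import Coquelicot.
Open Scope R_scope.

Definition Icc (a b x : R) : Prop := a <= x <= b.

(* [is_derive f x l] is by definition [filterdiff f (locally x) (fun h => scal h l)];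
   here the neighbourhood filter is restricted to [a, b], so that at [a] and [b]
   this is the one-sided derivative, and values of [f] outside [a, b] are irrelevant. *)
Definition is_derive_Icc (a b : R) (f : R -> R) (x l : R) : Prop :=
  filterdiff f (within (Icc a b) (locally x)) (fun h => scal h l).

Definition C1_Icc (a b : R) (f : R -> R) : Prop :=
  exists f' : R -> R,
    (forall x, Icc a b x -> is_derive_Icc a b f x (f' x)) /\
    continuous_on (Icc a b) f'.

(* All orders up to [n] are listed because [Derive_n] is total: [ex_derive_n f n x]
   alone does not assert that the lower derivatives exist. *)
Definition Cn_Ioo (n : nat) (a b : R) (f : R -> R) : Prop :=
  forall x, a < x < b ->
  forall k, (k <= n)%nat -> ex_derive_n f k x /\ continuous (Derive_n f k) x.

Definition is_solution (d : R) (phi : R -> R) : Prop :=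
  Cn_Ioo 3 0 d phi /\ C1_Icc 0 d phi /\
  (forall eta, 0 < eta < d -> 0 < phi eta) /\
  (forall eta, 0 < eta < d -> phi eta * Derive_n phi 3 eta = 1) /\
  phi 0 = 0 /\ phi d = 0 /\
  is_derive_Icc 0 d phi 0 1.

(* Main.v *)
Require Import Defs.
From Stdlib Require Import Reals Psatz ClassicalEpsilon.
From Coquelicot Require Import Coquelicot.
Open Scope R_scope.

(* Since [(phi phi'' - phi' ^ 2 / 2)' = phi phi''' = 1], a solution satisfies
   [phi phi'' - phi' ^ 2 / 2 = x + c], and continuity of [phi'] at [0] forces
   [c = - 1 / 2].  Hence [u = sqrt phi] solves [u'' = - (1 - 2 x) / (4 u ^ 3)] on
   (0, 1/2) and vanishes at both ends; the right-hand side is increasing in [u],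
   so uniqueness follows from the maximum principle.

   For existence put [s = ln (2 x / (1 - 2 x)) / 2] and [phi x = x (1 - 2 x) w(s) ^ 2].
   The equation becomes [w'' = w - w ^ -3 / (1 + exp (2 s))] on the whole line, with
   the subsolution [beta s = (1 + exp s) ^ (-1/2)] and the supersolutions [1] and
   [sqrt 2 * beta].  Once [9 w] is subtracted from both sides, inverting [D ^ 2 - 9]
   on bounded functions gives a monotone map of the Lipschitz functions between these
   barriers, which has a fixed point by Knaster-Tarski.  The barriers yield [w -> 1]
   at [-oo] and [w -> 0] at [+oo], that is [phi' 0 = 1] and [phi' (1/2) = 0]. *)

(** * Bounded solutions of [w'' = m ^ 2 w - f] on the line *)

Lemma mvt (f df : R -> R) (a b : R) :
  a < b -> (forall x, a <= x <= b -> is_derive f x (df x)) ->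
  exists c, a <= c <= b /\ f b - f a = df c * (b - a).
Proof.
  intros Hab Hf.
  destruct (MVT_gen f a b df) as [c Hc].
  - rewrite Rmin_left, Rmax_right by lra. intros x Hx. apply Hf. lra.
  - rewrite Rmin_left, Rmax_right by lra. intros x Hx.
    apply continuity_pt_filterlim, (ex_derive_continuous f x).
    exists (df x). now apply Hf.
  - rewrite Rmin_left, Rmax_right in Hc by lra. now exists c.
Qed.

Lemma nondecreasing_of_derive (f df : R -> R) (a b : R) :
  a <= b -> (forall x, a <= x <= b -> is_derive f x (df x)) ->
  (forall x, a <= x <= b -> 0 <= df x) -> f a <= f b.
Proof.
  intros [Hab | ->] Hf Hpos; [|lra].
  destruct (mvt f df a b Hab Hf) as [c [Hc E]].
  specialize (Hpos c Hc). nra.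
Qed.

(** The function [exp (m * t) * z t] is nondecreasing, so a negative value of [z] would grow
    exponentially in modulus towards -oo and break the bound [K]. *)
Lemma bounded_decay_nonneg (m K : R) (z dz : R -> R) :
  0 < m -> (forall t, is_derive z t (dz t)) ->
  (forall t, - m * z t <= dz t) -> (forall t, Rabs (z t) <= K) ->
  forall t, 0 <= z t.
Proof.
  intros Hm Hz Hineq HK t.
  destruct (Rle_or_lt 0 (z t)) as [|Hneg]; [assumption|exfalso].
  (* Since [exp (m * T) >= 1 + m * T], this choice pushes [z (t - T)] down to at most
     [z t - K < - K]. *)
  set (T := K / (m * - z t)).
  assert (HK0 : 0 <= K) by (generalize (HK t) (Rabs_pos (z t)); lra).
  assert (HT : 0 <= T) by (apply Rdiv_le_0_compat; nra).
  assert (Hmono : exp (m * (t - T)) * z (t - T) <= exp (m * t) * z t).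
  { apply (nondecreasing_of_derive (fun x => exp (m * x) * z x)
             (fun x => exp (m * x) * (m * z x + dz x))); [lra| |].
    - intros x _. assert (E := is_derive_unique z x (dz x) (Hz x)).
      auto_derive.
      + exists (dz x). apply Hz.
      + change (Derive (fun y => z y) x) with (Derive z x). rewrite E. ring.
    - intros x _. generalize (Hineq x) (exp_pos (m * x)). intros. nra. }
  assert (Hexp : exp (m * t) = exp (m * (t - T)) * exp (m * T)).
  { rewrite <- exp_plus. f_equal. ring. }
  rewrite Hexp in Hmono.
  assert (H1 := exp_pos (m * (t - T))).
  assert (H2 := exp_ineq1_le (m * T)).
  assert (H3 : m * T * - z t = K) by (unfold T; field; lra).
  assert (H4 : z (t - T) <= exp (m * T) * z t).
  { apply (Rmult_le_reg_l (exp (m * (t - T)))); lra. }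
  generalize (proj1 (Rabs_le_between _ _) (HK (t - T))). nra.
Qed.

Lemma is_derive_reflect (f : R -> R) (t l : R) :
  is_derive f (- t) l -> is_derive (fun x => f (- x)) t (- l).
Proof.
  intros H. assert (E := is_derive_unique _ _ _ H).
  auto_derive; [now exists l|]. change (Derive (fun x => f x) (- t)) with (Derive f (-t)). rewrite E. ring.
Qed.

Lemma bounded_growth_nonneg (m K : R) (z dz : R -> R) :
  0 < m -> (forall t, is_derive z t (dz t)) ->
  (forall t, dz t <= m * z t) -> (forall t, Rabs (z t) <= K) ->
  forall t, 0 <= z t.
Proof.
  intros Hm Hz Hineq HK t.
  rewrite <- (Ropp_involutive t).
  apply (bounded_decay_nonneg m K (fun x => z (- x)) (fun x => - dz (- x))); auto.
  - intros x. apply is_derive_reflect, Hz.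
  - intros x. generalize (Hineq (- x)). lra.
Qed.

(** The bounds act as boundary conditions at -oo and +oo: they exclude the homogeneous solutions
    [exp (m t)] and [exp (- m t)]. *)
Definition bounded_C2 (A B : R) (w dw ddw : R -> R) : Prop :=
  forall t, is_derive w t (dw t) /\ is_derive dw t (ddw t) /\
    Rabs (w t) <= A /\ Rabs (dw t) <= B.

(* With [w = b - a] the hypothesis reads [(D - m) (D + m) w <= 0], so the
   first-order lemmas apply in turn to [(D + m) w] and to [w]. *)
Lemma comparison (m A B A' B' : R) (a da dda b db ddb : R -> R) :
  0 < m -> bounded_C2 A B a da dda -> bounded_C2 A' B' b db ddb ->
  (forall t, ddb t - m ^ 2 * b t <= dda t - m ^ 2 * a t) ->
  forall t, a t <= b t.
Proof.
  intros Hm Ha Hb Hineq.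
  set (w := fun t => b t - a t). set (dw := fun t => db t - da t).
  assert (Hw : forall t, is_derive w t (dw t)).
  { intros t. apply (is_derive_minus b a); [apply Hb|apply Ha]. }
  assert (Hdw : forall t, is_derive dw t (ddb t - dda t)).
  { intros t. apply (is_derive_minus db da); [apply Hb|apply Ha]. }
  assert (HA : forall t, Rabs (w t) <= A + A').
  { intros t. destruct (Ha t) as (_ & _ & H1 & _). destruct (Hb t) as (_ & _ & H2 & _).
    apply Rabs_le_between in H1, H2. apply Rabs_le_between. unfold w. lra. }
  assert (HB : forall t, Rabs (dw t) <= B + B').
  { intros t. destruct (Ha t) as (_ & _ & _ & H1). destruct (Hb t) as (_ & _ & _ & H2).
    apply Rabs_le_between in H1, H2. apply Rabs_le_between. unfold dw. lra. }
  assert (Hz : forall t, 0 <= dw t + m * w t).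
  { apply (bounded_growth_nonneg m (B + B' + m * (A + A')) _
             (fun t => ddb t - dda t + m * dw t)); auto.
    - intros t. apply (is_derive_plus dw (fun x => m * w x)); [apply Hdw|].
      now apply is_derive_scal.
    - intros t. generalize (Hineq t). unfold w. nra.
    - intros t. eapply Rle_trans; [apply Rabs_triang|].
      rewrite Rabs_mult, (Rabs_pos_eq m) by lra.
      generalize (HA t) (HB t). nra. }
  intros t. apply Rminus_le_0.
  apply (bounded_decay_nonneg m (A + A') w dw); auto.
  intros s. generalize (Hz s). lra.
Qed.

(* The bounded solution is [exp (- m t) * integral of exp (m s) f s from -oo to t];
   the constant [C] is the part of the integral below [0], obtained as a supremum. *)
Lemma bounded_solution_decay (m K : R) (f : R -> R) :
  0 < m -> (forall t, continuous f t) -> (forall t, Rabs (f t) <= K) ->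
  exists y : R -> R, forall t,
    is_derive y t (f t - m * y t) /\ Rabs (y t) <= K / m.
Proof.
  intros Hm Hf HK.
  set (P := fun t => RInt (fun s => exp (m * s) * f s) 0 t).
  assert (HP : forall t, is_derive P t (exp (m * t) * f t)).
  { intros t.
    assert (Hc : forall s, continuous (fun s => exp (m * s) * f s) s).
    { intros s. apply (continuous_mult (fun s => exp (m * s)) f); [|apply Hf].
      apply (ex_derive_continuous (fun s => exp (m * s))). auto_derive. trivial. }
    apply (is_derive_RInt (fun s => exp (m * s) * f s) P 0); [|apply Hc].
    exists (mkposreal 1 Rlt_0_1). intros s _.
    apply (RInt_correct (V := R_CompleteNormedModule)), (ex_RInt_continuous (V := R_CompleteNormedModule)). auto. }
  (* The derivative of [E] dominates that of [P] in modulus, so [E + P] and [E - P] are both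
     nondecreasing. *)
  set (E := fun t => K / m * exp (m * t)).
  assert (HE : forall t, is_derive E t (K * exp (m * t))).
  { intros t. unfold E. auto_derive; [trivial|]. field. lra. }
  assert (HE0 : forall t, 0 <= E t).
  { intros t. apply Rmult_le_pos; [|left; apply exp_pos].
    apply Rdiv_le_0_compat; [|lra]. generalize (HK 0) (Rabs_pos (f 0)). lra. }
  assert (Hfb : forall t, - K <= f t <= K).
  { intros t. apply Rabs_le_between, HK. }
  assert (Hup : forall s t, s <= t -> P s + E s <= P t + E t).
  { intros s t Hst.
    apply (nondecreasing_of_derive (fun x => P x + E x)
             (fun x => exp (m * x) * f x + K * exp (m * x))); [lra| |].
    - intros x _. apply (is_derive_plus P E); auto.
    - intros x _. generalize (Hfb x) (exp_pos (m * x)). nra. }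
  assert (Hdn : forall s t, s <= t -> E s - P s <= E t - P t).
  { intros s t Hst.
    apply (nondecreasing_of_derive (fun x => E x - P x)
             (fun x => K * exp (m * x) - exp (m * x) * f x)); [lra| |].
    - intros x _. apply (is_derive_minus E P); auto.
    - intros x _. generalize (Hfb x) (exp_pos (m * x)). nra. }
  assert (Hcross : forall s t, - (P s + E s) <= E t - P t).
  { intros s t. destruct (Rle_or_lt s t) as [Hst | Hst].
    - generalize (Hdn s t Hst) (HE0 s). lra.
    - generalize (Hup t s (Rlt_le _ _ Hst)) (HE0 t). lra. }
  (* By [Hcross] this supremum lies below every [E t - P t]; the two resulting inequalities say that
     [C + P] is bounded by [E] in modulus. *)
  destruct (completeness (fun x => exists s, x = - (P s + E s))) as [C [HC1 HC2]].
  { exists (E 0 - P 0). intros x [s ->]. apply Hcross. }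
  { exists (- (P 0 + E 0)). now exists 0. }
  assert (HC : forall t, Rabs (C + P t) <= E t).
  { intros t. apply Rabs_le_between. split.
    - generalize (HC1 _ (ex_intro _ t eq_refl)). lra.
    - assert (C <= E t - P t); [|lra]. apply HC2. intros x [s ->]. apply Hcross. }
  exists (fun t => exp (- (m * t)) * (C + P t)). intros t. split.
  - assert (EP := is_derive_unique P t _ (HP t)).
    assert (He : exp (- (m * t)) * exp (m * t) = 1).
    { rewrite <- exp_plus, Rplus_opp_l. apply exp_0. }
    auto_derive.
    + exists (exp (m * t) * f t). apply HP.
    + change (Derive (fun x => P x) t) with (Derive P t). rewrite EP.
      rewrite Rmult_1_l, <- (Rmult_assoc (exp (- (m * t)))), He. ring.
  - rewrite Rabs_mult, Rabs_pos_eq by (left; apply exp_pos).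
    replace (K / m) with (exp (- (m * t)) * E t).
    + apply Rmult_le_compat_l; [left; apply exp_pos|apply HC].
    + unfold E. replace (exp (- (m * t)) * (K / m * exp (m * t)))
        with (K / m * (exp (- (m * t)) * exp (m * t))) by ring.
      rewrite <- exp_plus, Rplus_opp_l, exp_0. ring.
Qed.

(** Both bounds depend on [f] only through [K]; the one on [dw] becomes the Lipschitz constant
    [10 / 3] of the fixed-point argument. *)
Definition bounded_solution (m K : R) (f w : R -> R) : Prop :=
  exists dw, bounded_C2 (K / m ^ 2) (K / m) w dw (fun t => m ^ 2 * w t - f t).

(** Partial fractions: [1 / (m ^ 2 - D ^ 2)] is [1 / (2 m)] times the sum of [1 / (m + D)] and
    [1 / (m - D)]. The first-order lemma inverts [m + D], and its reflection in [t] inverts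
    [m - D]. *)
Lemma bounded_solution_exists (m K : R) (f : R -> R) :
  0 < m -> (forall t, continuous f t) -> (forall t, Rabs (f t) <= K) ->
  exists w, bounded_solution m K f w.
Proof.
  intros Hm Hf HK.
  destruct (bounded_solution_decay m K f Hm Hf HK) as [y Hy].
  destruct (bounded_solution_decay m K (fun t => f (- t)) Hm) as [x Hx].
  { intros t. apply (continuous_comp Ropp f); [|apply Hf].
    apply (continuous_opp (fun x : R => x)), continuous_id. }
  { auto. }
  assert (Hz : forall t, is_derive (fun s => x (- s)) t (m * x (- t) - f t)).
  { intros t. replace (m * x (- t) - f t) with (- (f (- - t) - m * x (- t))).
    - apply is_derive_reflect, Hx.
    - rewrite Ropp_involutive. ring. }
  exists (fun t => / (2 * m) * (y t + x (- t))), (fun t => / 2 * (x (- t) - y t)).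
  intros t.
  destruct (Hy t) as [Hy1 Hy2]. destruct (Hx (- t)) as [_ Hx2].
  split; [|split; [|split]].
  - replace (/ 2 * (x (- t) - y t))
      with (/ (2 * m) * ((f t - m * y t) + (m * x (- t) - f t))) by (field; lra).
    apply is_derive_scal, (is_derive_plus y (fun s => x (- s))); auto.
  - replace (m ^ 2 * (/ (2 * m) * (y t + x (- t))) - f t)
      with (/ 2 * ((m * x (- t) - f t) - (f t - m * y t))) by (field; lra).
    apply is_derive_scal, (is_derive_minus (fun s => x (- s)) y); auto.
  - rewrite Rabs_mult, Rabs_pos_eq by (left; apply Rinv_0_lt_compat; lra).
    replace (K / m ^ 2) with (/ (2 * m) * (K / m + K / m)) by (field; lra).
    apply Rmult_le_compat_l; [left; apply Rinv_0_lt_compat; lra|].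
    eapply Rle_trans; [apply Rabs_triang|lra].
  - rewrite Rabs_mult, Rabs_pos_eq by lra.
    eapply Rle_trans; [apply Rmult_le_compat_l; [lra|apply Rabs_triang]|].
    rewrite Rabs_Ropp. lra.
Qed.

(** * The profile equation *)

Lemma lipschitz_of_derive (L : R) (f df : R -> R) :
  (forall t, is_derive f t (df t)) -> (forall t, Rabs (df t) <= L) ->
  forall s t, Rabs (f s - f t) <= L * Rabs (s - t).
Proof.
  intros Hf HL.
  assert (H : forall s t, s < t -> Rabs (f t - f s) <= L * Rabs (t - s)).
  { intros s t Hst. destruct (mvt f df s t Hst) as [c [_ E]]; [auto|].
    rewrite E, Rabs_mult. apply Rmult_le_compat_r; [apply Rabs_pos|apply HL]. }
  intros s t. destruct (Rtotal_order s t) as [Hst | [-> | Hst]].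
  - rewrite (Rabs_minus_sym (f s)), (Rabs_minus_sym s). now apply H.
  - rewrite !Rminus_diag, Rabs_R0. lra.
  - now apply H.
Qed.

(** A common Lipschitz constant is imposed because a pointwise supremum of merely continuous
    functions may be discontinuous, while the linear problem asks for a continuous right-hand
    side. *)
Definition lipschitz_between (L : R) (lo hi w : R -> R) : Prop :=
  (forall s t, Rabs (w s - w t) <= L * Rabs (s - t)) /\
  forall s, lo s <= w s <= hi s.

Lemma lipschitz_between_continuous (L : R) (lo hi w : R -> R) :
  lipschitz_between L lo hi w -> forall t, continuous w t.
Proof.
  intros [HL _] t. apply filterlim_locally. intros eps.
  assert (H0 : 0 < eps / (Rabs L + 1)).
  { apply Rdiv_lt_0_compat; [apply eps|]. generalize (Rabs_pos L). lra. }
  exists (mkposreal _ H0). intros y Hy.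
  change (Rabs (y - t) < eps / (Rabs L + 1)) in Hy. change (Rabs (w y - w t) < eps).
  apply Rlt_div_r in Hy; [|generalize (Rabs_pos L); lra].
  generalize (HL y t) (Rle_abs L) (Rabs_pos (y - t)). nra.
Qed.

(* Knaster-Tarski: a pointwise supremum of [L]-Lipschitz functions is [L]-Lipschitz. *)
Lemma monotone_fixpoint (L : R) (lo hi : R -> R) (T : (R -> R) -> R -> R) :
  lipschitz_between L lo hi lo ->
  (forall w, lipschitz_between L lo hi w -> lipschitz_between L lo hi (T w)) ->
  (forall v w, lipschitz_between L lo hi v -> lipschitz_between L lo hi w ->
     (forall s, v s <= w s) -> forall s, T v s <= T w s) ->
  exists w, lipschitz_between L lo hi w /\ forall s, T w s = w s.
Proof.
  intros Hlo HT Hmono.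
  set (post := fun w => lipschitz_between L lo hi w /\ forall s, w s <= T w s).
  assert (Hpost : post lo).
  { split; [assumption|]. apply (HT lo Hlo). }
  set (E := fun s x => exists w, post w /\ x = w s).
  assert (Hbound : forall s, bound (E s)).
  { intros s. exists (hi s). intros x [w [[Hw _] ->]]. apply Hw. }
  assert (Hne : forall s, exists x, E s x).
  { intros s. exists (lo s), lo. now split. }
  set (W := fun s => proj1_sig (completeness (E s) (Hbound s) (Hne s))).
  assert (HW : forall s, is_lub (E s) (W s)).
  { intros s. unfold W. destruct completeness. assumption. }
  assert (Hub : forall w, post w -> forall s, w s <= W s).
  { intros w Hw s. apply (proj1 (HW s)). now exists w. }
  assert (Hlub : forall s M, (forall w, post w -> w s <= M) -> W s <= M).
  { intros s M HM. apply (proj2 (HW s)). intros x [w [Hw ->]]. auto. }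
  assert (HWX : lipschitz_between L lo hi W).
  { split.
    - assert (H : forall s t, W s <= W t + L * Rabs (s - t)).
      { intros s t. apply Hlub. intros w Hw.
        generalize (proj1 (proj1 Hw) s t) (Rle_abs (w s - w t)) (Hub w Hw t). lra. }
      intros s t. apply Rabs_le_between.
      generalize (H s t) (H t s). rewrite (Rabs_minus_sym t s). lra.
    - intros s. split; [now apply Hub|].
      apply Hlub. intros w Hw. apply Hw. }
  assert (HWT : forall s, W s <= T W s).
  { intros s. apply Hlub. intros w Hw. eapply Rle_trans; [apply Hw|].
    apply Hmono; [apply Hw|assumption|]. now apply Hub. }
  exists W. split; [assumption|]. intros s. apply Rle_antisym; [|apply HWT].
  apply Hub. split; [now apply HT|]. apply Hmono; auto.
Qed.

(** * Monotonicity of the forcing, and the barriers *)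

Definition beta (s : R) : R := / sqrt (1 + exp s).

(* The equation [w'' = w - w ^ -3 / (1 + exp (2 s))] is written [w'' = 9 w - forcing s w]:
   the coefficient [9] is large enough for [forcing s] to be increasing above [beta s]. *)
Definition forcing (s w : R) : R := 8 * w + / (1 + exp s ^ 2) / w ^ 3.

Lemma sqrt_1_exp (s : R) :
  1 < sqrt (1 + exp s) /\ sqrt (1 + exp s) ^ 2 = 1 + exp s.
Proof.
  generalize (exp_pos s). intros He.
  assert (H : sqrt (1 + exp s) ^ 2 = 1 + exp s) by (apply pow2_sqrt; lra).
  split; [|assumption]. rewrite <- sqrt_1 at 1. apply sqrt_lt_1_alt. lra.
Qed.

Lemma beta_bounds (s : R) : 0 < beta s <= 1.
Proof.
  destruct (sqrt_1_exp s) as [H _]. unfold beta. split.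
  - apply Rinv_0_lt_compat. lra.
  - rewrite <- Rinv_1 at 2. apply Rinv_le_contravar; lra.
Qed.

Lemma beta_sqr (s : R) : beta s ^ 2 = / (1 + exp s).
Proof.
  unfold beta. rewrite <- (proj2 (sqrt_1_exp s)) at 2.
  field. generalize (sqrt_1_exp s). lra.
Qed.

(** The derivatives are [beta] times polynomials in [tau = exp s / (1 + exp s)], which lies in
    [0, 1]; the barrier inequalities become polynomial inequalities in [tau]. *)
Definition dbeta (s : R) : R := - (1 / 2) * (exp s / (1 + exp s)) * beta s.
Definition ddbeta (s : R) : R :=
  (3 * (exp s / (1 + exp s)) ^ 2 - 2 * (exp s / (1 + exp s))) / 4 * beta s.

Lemma is_derive_beta (s : R) : is_derive beta s (dbeta s).
Proof.
  unfold beta, dbeta. generalize (exp_pos s) (sqrt_1_exp s). intros He [H1 H2].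
  auto_derive.
  - repeat split; lra.
  - unfold beta. set (r := sqrt (1 + exp s)) in *.
    replace (exp s) with (r ^ 2 - 1) by lra. field. nra.
Qed.

Lemma is_derive_dbeta (s : R) : is_derive dbeta s (ddbeta s).
Proof.
  unfold dbeta. generalize (exp_pos s). intros He.
  assert (E := is_derive_unique _ _ _ (is_derive_beta s)).
  auto_derive.
  - repeat split; try lra. exists (dbeta s). apply is_derive_beta.
  - change (Derive (fun x => beta x) s) with (Derive beta s). rewrite E.
    unfold ddbeta, dbeta. field. lra.
Qed.

Lemma bounded_C2_beta : bounded_C2 1 1 beta dbeta ddbeta.
Proof.
  intros s. split; [apply is_derive_beta|split; [apply is_derive_dbeta|]].
  generalize (beta_bounds s) (exp_pos s). intros Hb He.
  assert (0 <= exp s / (1 + exp s) <= 1).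
  { split; [apply Rdiv_le_0_compat; lra|]. apply Rle_div_l; lra. }
  unfold dbeta. split; apply Rabs_le_between; nra.
Qed.

(** With [e = exp s] the ratio is [(1 + e) ^ 2 / (1 + e ^ 2)], and [2 e <= 1 + e ^ 2]. The upper
    bound controls the slope of the singular term of [forcing] above [beta]. *)
Lemma forcing_beta_ratio (s : R) :
  1 <= / (1 + exp s ^ 2) * (/ beta s) ^ 4 <= 2.
Proof.
  generalize (exp_pos s) (pow2_ge_0 (1 - exp s)). intros He Hsq.
  replace ((/ beta s) ^ 4) with ((1 + exp s) ^ 2).
  - split.
    + apply (Rmult_le_reg_l (1 + exp s ^ 2)); [nra|].
      rewrite <- Rmult_assoc, Rinv_r by nra. nra.
    + apply (Rmult_le_reg_l (1 + exp s ^ 2)); [nra|].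
      rewrite <- Rmult_assoc, Rinv_r by nra. nra.
  - unfold beta. rewrite Rinv_inv.
    replace (sqrt (1 + exp s) ^ 4) with ((sqrt (1 + exp s) ^ 2) ^ 2) by ring.
    now rewrite (proj2 (sqrt_1_exp s)).
Qed.

(** Above [beta s] the slope of the singular term is at least [- 3 g / beta s ^ 4 >= - 6], which the
    slope 8 of the linear term outweighs. The proof estimates the difference quotient, factored in
    the reciprocals [a] and [b]. *)
Lemma forcing_increasing (s v w : R) :
  beta s <= v -> v <= w -> forcing s v <= forcing s w.
Proof.
  intros Hv Hvw. generalize (beta_bounds s) (forcing_beta_ratio s). intros Hb Hr.
  set (g := / (1 + exp s ^ 2)) in *. set (r := / beta s) in *.
  assert (Hg : 0 < g) by (apply Rinv_0_lt_compat; nra).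
  set (a := / v). set (b := / w).
  assert (Hb0 : 0 < b) by (apply Rinv_0_lt_compat; lra).
  assert (Hba : b <= a) by (apply Rinv_le_contravar; lra).
  assert (Har : a <= r) by (apply Rinv_le_contravar; lra).
  assert (E : forcing s w - forcing s v
              = (w - v) * (8 - g * (a * b * (a ^ 2 + a * b + b ^ 2)))).
  { unfold forcing, a, b. fold g. field. lra. }
  assert (H1 : a * b <= r ^ 2) by nra.
  assert (H2 : a ^ 2 + a * b + b ^ 2 <= 3 * r ^ 2) by nra.
  assert (H3 : a * b * (a ^ 2 + a * b + b ^ 2) <= 3 * r ^ 4).
  { replace (3 * r ^ 4) with (r ^ 2 * (3 * r ^ 2)) by ring.
    apply Rmult_le_compat; nra. }
  assert (H4 : g * (a * b * (a ^ 2 + a * b + b ^ 2)) <= 6).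
  { apply Rle_trans with (g * (3 * r ^ 4)); [|lra].
    apply Rmult_le_compat_l; lra. }
  nra.
Qed.

Lemma forcing_bounds (s w : R) :
  beta s <= w <= 1 -> Rabs (forcing s w) <= 10.
Proof.
  intros [Hw1 Hw2]. generalize (beta_bounds s) (forcing_beta_ratio s). intros Hb Hr.
  apply Rabs_le_between. split.
  - assert (0 <= / (1 + exp s ^ 2) / w ^ 3); [|unfold forcing; lra].
    apply Rdiv_le_0_compat; [left; apply Rinv_0_lt_compat; nra|apply pow_lt; lra].
  - eapply Rle_trans; [apply (forcing_increasing s w 1); assumption|].
    unfold forcing. replace (1 ^ 3) with 1 by ring.
    assert (/ (1 + exp s ^ 2) <= / 1) by (apply Rinv_le_contravar; nra). lra.
Qed.

Lemma forcing_continuous (w : R -> R) (t : R) :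
  continuous w t -> 0 < w t -> continuous (fun s => forcing s (w s)) t.
Proof.
  intros Hc Hw.
  apply (continuous_comp_2 (fun s => s) w forcing); [apply continuous_id|assumption|].
  unfold forcing.
  apply (continuous_plus (fun z : R * R => 8 * snd z)
           (fun z => / (1 + exp (fst z) ^ 2) / snd z ^ 3)).
  - apply (continuous_scal_r 8 (fun z : R * R => snd z)), continuous_snd.
  - apply (continuous_mult (fun z : R * R => / (1 + exp (fst z) ^ 2)) (fun z => / snd z ^ 3)).
    + apply (continuous_comp fst (fun x => / (1 + exp x ^ 2))); [apply continuous_fst|].
      apply (ex_derive_continuous (fun x => / (1 + exp x ^ 2))).
      auto_derive. generalize (exp_pos t). simpl. nra.
    + apply (continuous_comp snd (fun x => / x ^ 3)); [apply continuous_snd|].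
      apply (ex_derive_continuous (fun x => / x ^ 3)).
      auto_derive. simpl. apply Rgt_not_eq. repeat apply Rmult_lt_0_compat; lra.
Qed.

(** The constant is the smaller barrier for [s <= 0]; for [s >= 0] it is [sqrt 2 * beta], which
    supplies the decay at +oo. *)
Definition upper (s : R) : R := Rmin 1 (sqrt 2 * beta s).

(** Divided by [beta], the singular term is [1 / (1 - 2 tau (1 - tau))], at least
    [1 + 2 tau (1 - tau)]. What remains is [tau (6 - 5 tau) >= 0]. *)
Lemma beta_subsolution (s : R) : 9 * beta s - forcing s (beta s) <= ddbeta s.
Proof.
  generalize (exp_pos s) (beta_bounds s). intros He Hb.
  set (tau := exp s / (1 + exp s)).
  assert (Ht : 0 <= tau <= 1).
  { unfold tau. split; [apply Rdiv_le_0_compat; lra|]. apply Rle_div_l; lra. }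
  assert (E : / (1 + exp s ^ 2) / beta s ^ 3
              = beta s * ((1 + exp s) ^ 2 / (1 + exp s ^ 2))).
  { replace (1 + exp s) with (/ beta s ^ 2) by (rewrite beta_sqr, Rinv_inv; ring).
    field. split; nra. }
  assert (H : 1 + 2 * tau * (1 - tau) <= (1 + exp s) ^ 2 / (1 + exp s ^ 2)).
  { replace ((1 + exp s) ^ 2 / (1 + exp s ^ 2)) with (/ (1 - 2 * tau * (1 - tau))).
    - apply (Rmult_le_reg_l (1 - 2 * tau * (1 - tau))); [nra|].
      rewrite Rinv_r by nra. generalize (pow2_ge_0 (tau * (1 - tau))). lra.
    - unfold tau. field. repeat split; nra. }
  unfold forcing, ddbeta. fold tau. rewrite E.
  assert (beta s * (1 + 2 * tau * (1 - tau))
          <= beta s * ((1 + exp s) ^ 2 / (1 + exp s ^ 2))) by (apply Rmult_le_compat_l; lra).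
  assert (0 <= beta s * (tau * (6 - 5 * tau))) by (apply Rmult_le_pos; [lra|nra]).
  lra.
Qed.

(** After division by [sqrt 2 * beta], the left side is at most [1 / 4]. The factor [sqrt 2] scales
    the ratio [q <= 2] by [1 / 4], so the right side [1 - q / 4] is at least [1 / 2]. *)
Lemma sqrt2_beta_supersolution (s : R) :
  sqrt 2 * ddbeta s <= 9 * (sqrt 2 * beta s) - forcing s (sqrt 2 * beta s).
Proof.
  generalize (exp_pos s) (beta_bounds s) (forcing_beta_ratio s). intros He Hb [_ Hr].
  assert (Hs : sqrt 2 ^ 2 = 2) by (apply pow2_sqrt; lra).
  assert (Hs0 : 0 < sqrt 2) by (apply sqrt_lt_R0; lra).
  set (tau := exp s / (1 + exp s)).
  assert (Ht : 0 <= tau <= 1).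
  { unfold tau. split; [apply Rdiv_le_0_compat; lra|]. apply Rle_div_l; lra. }
  assert (E : / (1 + exp s ^ 2) / (sqrt 2 * beta s) ^ 3
              = sqrt 2 * beta s * (/ (1 + exp s ^ 2) * (/ beta s) ^ 4 / 4)).
  { replace 4 with (sqrt 2 ^ 2 * sqrt 2 ^ 2) by (rewrite Hs; ring).
    field. repeat split; nra. }
  unfold forcing, ddbeta. fold tau. rewrite E.
  assert (0 < sqrt 2 * beta s) by nra.
  set (q := / (1 + exp s ^ 2) * (/ beta s) ^ 4) in *.
  assert ((3 * tau ^ 2 - 2 * tau) / 4 <= 1 - q / 4) by nra.
  assert (sqrt 2 * beta s * ((3 * tau ^ 2 - 2 * tau) / 4) <= sqrt 2 * beta s * (1 - q / 4))
    by (apply Rmult_le_compat_l; lra).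
  lra.
Qed.

Lemma one_supersolution (s : R) : 0 <= 9 * 1 - forcing s 1.
Proof.
  generalize (exp_pos s). intros He. unfold forcing. replace (1 ^ 3) with 1 by ring.
  assert (/ (1 + exp s ^ 2) <= / 1) by (apply Rinv_le_contravar; nra). lra.
Qed.

Definition is_profile (w dw : R -> R) : Prop :=
  forall s,
    is_derive w s (dw s) /\ is_derive dw s (w s - / (1 + exp s ^ 2) / w s ^ 3) /\
    beta s <= w s <= 1 /\ w s <= sqrt 2 * beta s /\ Rabs (dw s) <= 10 / 3.

Lemma profile_exists : exists w dw : R -> R, is_profile w dw.
Proof.
  set (X := lipschitz_between (10 / 3) beta upper).
  (* [epsilon] turns the existence of a bounded solution into a map; its values are controlled only
     for [w] in [X]. *)
  set (T := fun w => epsilon (inhabits (fun _ : R => 0))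
                       (bounded_solution 3 10 (fun s => forcing s (w s)))).
  assert (Hup : forall s, upper s <= 1 /\ upper s <= sqrt 2 * beta s).
  { intros s. split; [apply Rmin_l|apply Rmin_r]. }
  assert (Hs1 : 1 <= sqrt 2) by (rewrite <- sqrt_1; apply sqrt_le_1_alt; lra).
  assert (HT : forall w, X w -> bounded_solution 3 10 (fun s => forcing s (w s)) (T w)).
  { intros w Hw. apply epsilon_spec, bounded_solution_exists; [lra| |].
    - intros t. apply forcing_continuous.
      + now apply (lipschitz_between_continuous (10 / 3) beta upper).
      + generalize (beta_bounds t) (proj2 Hw t). lra.
    - intros t. apply forcing_bounds. generalize (proj2 Hw t) (Hup t). lra. }
  destruct (monotone_fixpoint (10 / 3) beta upper T) as [w [Hw Hfix]].
  - split.
    + apply (lipschitz_of_derive _ beta dbeta); [apply bounded_C2_beta|].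
      intros t. generalize (bounded_C2_beta t). intros (_ & _ & _ & H). lra.
    + intros s. split; [lra|]. generalize (beta_bounds s). intros Hb.
      apply Rmin_glb; nra.
  - intros w Hw. destruct (HT w Hw) as [dw Hdw]. split.
    + apply (lipschitz_of_derive _ (T w) dw); apply Hdw.
    (* Monotonicity of [forcing] compares the right-hand side at [w] with that at each barrier. The
       two branches of [upper] are treated separately, since their minimum has a kink at 0. *)
    + intros s. split; [|apply Rmin_glb].
      * revert s. eapply (comparison 3); [|apply bounded_C2_beta|apply Hdw|]; [lra|].
        intros t. generalize (beta_subsolution t).
        generalize (forcing_increasing t (beta t) (w t) (Rle_refl _) (proj1 (proj2 Hw t))).
        lra.
      * revert s. eapply (comparison 3 _ _ 1 0 _ _ _ (fun _ => 1) (fun _ => 0) (fun _ => 0));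
          [lra|apply Hdw| |].
        { intros t. split; [|split]; [apply (is_derive_const 1 t)|apply (is_derive_const 0 t)|].
          rewrite Rabs_R1, Rabs_R0. lra. }
        intros t. generalize (one_supersolution t).
        destruct (proj2 Hw t) as [H1 H2].
        generalize (forcing_increasing t (w t) 1 H1 (Rle_trans _ _ _ H2 (proj1 (Hup t)))).
        lra.
      * revert s. eapply (comparison 3 _ _ (sqrt 2) (sqrt 2) _ _ _ (fun s => sqrt 2 * beta s)
          (fun s => sqrt 2 * dbeta s) (fun s => sqrt 2 * ddbeta s)); [lra|apply Hdw| |].
        { intros t. destruct (bounded_C2_beta t) as (H1 & H2 & H3 & H4).
          split; [|split; [|split]].
          - now apply is_derive_scal.
          - now apply is_derive_scal.
          - rewrite Rabs_mult, Rabs_pos_eq; nra.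
          - rewrite Rabs_mult, Rabs_pos_eq; nra. }
        intros t. generalize (sqrt2_beta_supersolution t).
        destruct (proj2 Hw t) as [H1 H2].
        generalize (forcing_increasing t (w t) _ H1 (Rle_trans _ _ _ H2 (proj2 (Hup t)))).
        lra.
  - intros v w Hv Hw Hvw. destruct (HT v Hv) as [dv Hdv]. destruct (HT w Hw) as [dw Hdw].
    eapply (comparison 3); [|apply Hdv|apply Hdw|]; [lra|].
    intros t. generalize (forcing_increasing t (v t) (w t) (proj1 (proj2 Hv t)) (Hvw t)).
    lra.
  - destruct (HT w Hw) as [dw Hdw]. exists w, dw. intros s.
    destruct (Hdw s) as (H1 & H2 & _ & H4).
    rewrite (Hfix s) in H2.
    split; [|split].
    + apply (is_derive_ext (T w)); assumption.
    + replace (w s - _) with (3 ^ 2 * w s - forcing s (w s)); [assumption|].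
      unfold forcing. ring.
    + generalize (proj2 Hw s) (Hup s). lra.
Qed.

(** * From the profile to a solution *)

(** As [w] stays within [exp s] of 1 on [s - 1, s], the mean value theorem finds a point there with
    [Rabs (dw c) <= exp s]. The second derivative, at most [2 * exp s] in modulus, carries the bound
    to [s]. *)
Lemma profile_at_minus_infinity (w dw : R -> R) :
  is_profile w dw -> forall s, s <= 0 ->
  1 - exp s <= w s /\ Rabs (dw s) <= 3 * exp s.
Proof.
  intros Hw.
  assert (Hexp : forall s t, s <= t -> exp s <= exp t).
  { intros s t [H | ->]; [left; now apply exp_increasing|lra]. }
  assert (Hlow : forall s, 1 - exp s <= w s).
  { intros s. destruct (Hw s) as (_ & _ & [H _] & _).
    generalize (beta_bounds s) (beta_sqr s) (exp_pos s). intros Hb E He.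
    assert (1 - exp s <= / (1 + exp s)).
    { apply (Rmult_le_reg_r (1 + exp s)); [lra|]. rewrite Rinv_l by lra. nra. }
    nra. }
  (* The barriers place this expression between [beta s - beta s * (1 + 2 * exp s)] and
     [1 - / (1 + exp s ^ 2)]. *)
  assert (Hdd : forall s t, s <= t -> t <= 0 ->
            Rabs (w s - / (1 + exp s ^ 2) / w s ^ 3) <= 2 * exp t).
  { intros s t Hst Ht. destruct (Hw s) as (_ & _ & [H1 H2] & _).
    generalize (beta_bounds s) (exp_pos s) (Hexp s t Hst). intros Hb He Het.
    assert (He1 : exp s <= 1) by (rewrite <- exp_0; apply Hexp; lra).
    set (g := / (1 + exp s ^ 2)).
    assert (Hg : 0 < g) by (apply Rinv_0_lt_compat; nra).
    assert (Hg1 : g * (1 + exp s ^ 2) = 1) by (apply Rinv_l; nra).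
    assert (Hw3 : 1 <= / w s ^ 3).
    { rewrite <- Rinv_1 at 1. apply Rinv_le_contravar; [apply pow_lt; lra|].
      replace 1 with (1 ^ 3) by ring. apply pow_incr. lra. }
    assert (Hb3 : / w s ^ 3 <= / beta s ^ 3).
    { apply Rinv_le_contravar; [apply pow_lt; lra|]. apply pow_incr. lra. }
    assert (Hratio : g * / beta s ^ 3 = beta s * (g * (1 + exp s) ^ 2)).
    { replace (1 + exp s) with (/ beta s ^ 2) by (rewrite beta_sqr, Rinv_inv; ring).
      field. lra. }
    assert (Hr2 : g * (1 + exp s) ^ 2 <= 1 + 2 * exp s) by nra.
    assert (g * / w s ^ 3 <= g * / beta s ^ 3) by (apply Rmult_le_compat_l; lra).
    assert (g <= g * / w s ^ 3) by nra.
    unfold Rdiv. apply Rabs_le_between. nra. }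
  intros s Hs. split; [apply Hlow|].
  destruct (mvt w dw (s - 1) s) as [c [Hc E]]; [lra|intros; apply Hw|].
  assert (Hdc : Rabs (dw c) <= exp s).
  { replace (dw c) with (w s - w (s - 1)) by lra. apply Rabs_le_between.
    generalize (Hlow s) (Hlow (s - 1)) (Hexp (s - 1) s).
    destruct (Hw s) as (_ & _ & H1 & _). destruct (Hw (s - 1)) as (_ & _ & H2 & _).
    intros. lra. }
  destruct (Req_dec c s) as [<- | Hcs].
  { generalize (exp_pos c). lra. }
  destruct (mvt dw (fun s => w s - / (1 + exp s ^ 2) / w s ^ 3) c s) as [e [He E2]];
    [lra|intros; apply Hw|].
  generalize (Hdd e s (proj2 He) Hs) (exp_pos s). intros H Hes.
  apply Rabs_le_between in H, Hdc. apply Rabs_le_between. nra.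
Qed.

(** The logarithmic variable [s], which sends the ends 0 and 1/2 to -oo and +oo. *)
Definition slow (x : R) : R := ln (2 * x / (1 - 2 * x)) / 2.

Lemma exp_slow_sqr (x : R) : 0 < x < 1 / 2 -> exp (slow x) ^ 2 = 2 * x / (1 - 2 * x).
Proof.
  intros Hx. replace (exp (slow x) ^ 2) with (exp (slow x) * exp (slow x)) by ring.
  rewrite <- exp_plus. unfold slow.
  replace (_ + _) with (ln (2 * x / (1 - 2 * x))) by lra.
  apply exp_ln, Rdiv_lt_0_compat; lra.
Qed.

Lemma is_derive_slow (x : R) :
  0 < x < 1 / 2 -> is_derive slow x (/ (2 * x * (1 - 2 * x))).
Proof.
  intros Hx. unfold slow. auto_derive.
  - repeat split; try lra. apply Rdiv_lt_0_compat; lra.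
  - field. lra.
Qed.

Lemma slow_near_left_end (eps : R) : 0 < eps ->
  exists delta, 0 < delta <= 1 / 4 /\
    forall x, 0 < x < delta -> slow x <= 0 /\ exp (slow x) <= eps.
Proof.
  intros Heps. set (m := Rmin 1 eps).
  assert (Hm : 0 < m <= 1 /\ m <= eps).
  { unfold m. split; [split; [apply Rmin_glb_lt; lra|apply Rmin_l]|apply Rmin_r]. }
  (* For [x < m ^ 2 / 4 <= 1 / 4] one has [exp (slow x) ^ 2 = 2 x / (1 - 2 x) <= 4 x <= m ^ 2];
     [m <= 1] then gives [slow x <= 0]. *)
  exists (m ^ 2 / 4). split; [nra|]. intros x Hx.
  assert (Hx4 : x < 1 / 4) by nra.
  assert (H := exp_slow_sqr x ltac:(lra)).
  assert (Hle : 2 * x / (1 - 2 * x) <= m ^ 2) by (apply Rle_div_l; nra).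
  generalize (exp_pos (slow x)). intros He.
  assert (exp (slow x) <= m) by nra.
  split; [|lra]. apply Rnot_lt_le. intros Hpos.
  generalize (exp_increasing _ _ Hpos). rewrite exp_0. lra.
Qed.

Lemma slow_near_right_end (eps : R) : 0 < eps ->
  exists delta, 0 < delta <= 1 / 4 /\
    forall x, 1 / 2 - delta < x < 1 / 2 -> / exp (slow x) <= eps.
Proof.
  intros Heps. set (m := Rmin 1 eps).
  assert (Hm : 0 < m <= 1 /\ m <= eps).
  { unfold m. split; [split; [apply Rmin_glb_lt; lra|apply Rmin_l]|apply Rmin_r]. }
  exists (m ^ 2 / 4). split; [nra|]. intros x Hx.
  assert (Hx4 : 1 / 4 < x) by nra.
  assert (H := exp_slow_sqr x ltac:(lra)).
  generalize (exp_pos (slow x)). intros He.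
  assert (Hle : (/ exp (slow x)) ^ 2 <= m ^ 2).
  { rewrite pow_inv, H. replace (/ (2 * x / (1 - 2 * x))) with ((1 - 2 * x) / (2 * x)) by (field; lra).
    apply Rle_div_l; nra. }
  assert (0 < / exp (slow x)) by (now apply Rinv_0_lt_compat).
  assert (/ exp (slow x) <= m) by nra. lra.
Qed.

(** * The function built from a profile, and its interior derivatives *)

Definition film (w : R -> R) (x : R) : R := x * (1 - 2 * x) * w (slow x) ^ 2.
Definition dfilm (w dw : R -> R) (x : R) : R :=
  (1 - 4 * x) * w (slow x) ^ 2 + w (slow x) * dw (slow x).
(** This is [phi''] solved from the energy identity [phi phi'' - phi' ^ 2 / 2 = x - 1 / 2]. In this
    form the derivative of the quotient simplifies at once to [1 / phi]. *)
Definition ddfilm (w dw : R -> R) (x : R) : R :=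
  (dfilm w dw x ^ 2 / 2 + x - 1 / 2) / film w x.

Lemma profile_pos (w dw : R -> R) : is_profile w dw -> forall s, 0 < w s.
Proof. intros Hw s. generalize (beta_bounds s). destruct (Hw s) as (_ & _ & H & _). lra. Qed.

Lemma film_pos (w dw : R -> R) (x : R) : is_profile w dw -> 0 < x < 1 / 2 -> 0 < film w x.
Proof.
  intros Hw Hx. generalize (profile_pos w dw Hw (slow x)). intros H. unfold film.
  repeat apply Rmult_lt_0_compat; lra.
Qed.

Lemma is_derive_film (w dw : R -> R) (x : R) :
  is_profile w dw -> 0 < x < 1 / 2 -> is_derive (film w) x (dfilm w dw x).
Proof.
  intros Hw Hx. destruct (Hw (slow x)) as (H1 & _).
  assert (E1 := is_derive_unique _ _ _ H1).
  assert (E2 := is_derive_unique _ _ _ (is_derive_slow x Hx)).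
  unfold film, dfilm. auto_derive.
  - repeat split; first [eexists; apply (is_derive_slow x Hx) | eexists; eassumption].
  - change (Derive (fun x => slow x) x) with (Derive slow x).
    change (Derive (fun x => w x) (slow x)) with (Derive w (slow x)).
    rewrite E1, E2. field. lra.
Qed.

Lemma is_derive_dfilm (w dw : R -> R) (x : R) :
  is_profile w dw -> 0 < x < 1 / 2 -> is_derive (dfilm w dw) x (ddfilm w dw x).
Proof.
  intros Hw Hx. destruct (Hw (slow x)) as (H1 & H2 & _).
  assert (E1 := is_derive_unique _ _ _ H1).
  assert (E2 := is_derive_unique _ _ _ H2).
  assert (E3 := is_derive_unique _ _ _ (is_derive_slow x Hx)).
  generalize (profile_pos w dw Hw (slow x)). intros Hpos.
  assert (Hg : / (1 + exp (slow x) ^ 2) = 1 - 2 * x).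
  { rewrite exp_slow_sqr by assumption. field. lra. }
  rewrite Hg in E2.
  unfold ddfilm. unfold film, dfilm. auto_derive.
  - repeat split; first [eexists; apply (is_derive_slow x Hx) | eexists; eassumption].
  - change (Derive (fun x => slow x) x) with (Derive slow x).
    change (Derive (fun x => w x) (slow x)) with (Derive w (slow x)).
    change (Derive (fun x => dw x) (slow x)) with (Derive dw (slow x)).
    rewrite E1, E2, E3. field. lra.
Qed.

Lemma is_derive_ddfilm (w dw : R -> R) (x : R) :
  is_profile w dw -> 0 < x < 1 / 2 -> is_derive (ddfilm w dw) x (/ film w x).
Proof.
  intros Hw Hx.
  assert (H1 := is_derive_film w dw x Hw Hx).
  assert (H2 := is_derive_dfilm w dw x Hw Hx).
  assert (E1 := is_derive_unique _ _ _ H1).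
  assert (E2 := is_derive_unique _ _ _ H2).
  generalize (film_pos w dw x Hw Hx). intros Hpos.
  unfold ddfilm. auto_derive.
  - repeat split; try (eexists; eassumption). lra.
  - change (Derive (fun x => film w x) x) with (Derive (film w) x).
    change (Derive (fun x => dfilm w dw x) x) with (Derive (dfilm w dw) x).
    rewrite E1, E2. unfold ddfilm. field. lra.
Qed.

(** * Derivatives and continuity on open and closed intervals *)

Lemma locally_Ioo (P : R -> Prop) (a b x : R) :
  a < x < b -> (forall y, a < y < b -> P y) -> locally x P.
Proof.
  intros Hx HP. apply (locally_interval P x a b); simpl; try tauto.
  intros y H1 H2. apply HP. now split.
Qed.

Lemma is_derive_Derive_n_Ioo (a b : R) (f g dg : R -> R) (k : nat) :
  (forall x, a < x < b -> Derive_n f k x = g x) ->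
  (forall x, a < x < b -> is_derive g x (dg x)) ->
  forall x, a < x < b ->
  is_derive (Derive_n f k) x (dg x) /\ Derive_n f (S k) x = dg x.
Proof.
  intros Hg Hdg x Hx.
  assert (H : is_derive (Derive_n f k) x (dg x)).
  { apply (is_derive_ext_loc g); [|auto].
    apply (locally_Ioo _ a b); [assumption|]. intros y Hy. now rewrite Hg. }
  split; [assumption|]. now apply is_derive_unique.
Qed.

Lemma Cn_Ioo_3_intro (a b : R) (f df ddf dddf : R -> R) :
  (forall x, a < x < b -> is_derive f x (df x)) ->
  (forall x, a < x < b -> is_derive df x (ddf x)) ->
  (forall x, a < x < b -> is_derive ddf x (dddf x)) ->
  (forall x, a < x < b -> continuous dddf x) ->
  Cn_Ioo 3 a b f /\ forall x, a < x < b -> Derive_n f 3 x = dddf x.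
Proof.
  intros H0 H1 H2 H3.
  assert (D0 := is_derive_Derive_n_Ioo a b f f df 0 (fun _ _ => eq_refl) H0).
  assert (D1 := is_derive_Derive_n_Ioo a b f df ddf 1 (fun x Hx => proj2 (D0 x Hx)) H1).
  assert (D2 := is_derive_Derive_n_Ioo a b f ddf dddf 2 (fun x Hx => proj2 (D1 x Hx)) H2).
  split; [|intros x Hx; apply (D2 x Hx)].
  intros x Hx k Hk.
  destruct k as [|[|[|[|k]]]]; [| | | |exfalso; lia].
  - split; [exact I|]. apply (ex_derive_continuous f). exists (df x). auto.
  - split; [exists (df x); apply (D0 x Hx)|].
    apply (ex_derive_continuous (Derive_n f 1)). exists (ddf x). apply (D1 x Hx).
  - split; [exists (ddf x); apply (D1 x Hx)|].
    apply (ex_derive_continuous (Derive_n f 2)). exists (dddf x). apply (D2 x Hx).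
  - split; [exists (dddf x); apply (D2 x Hx)|].
    apply (continuous_ext_loc _ dddf); [|auto].
    apply (locally_Ioo _ a b); [assumption|]. intros y Hy. symmetry. apply (D2 y Hy).
Qed.

Lemma is_derive_Icc_intro (a b : R) (f : R -> R) (x l : R) :
  (forall eps, 0 < eps -> exists delta, 0 < delta /\
     forall y, a <= y <= b -> Rabs (y - x) < delta ->
     Rabs (f y - f x - (y - x) * l) <= eps * Rabs (y - x)) ->
  a <= x <= b -> is_derive_Icc a b f x l.
Proof.
  intros H Hx. split; [apply (is_linear_scal_l (K := R_AbsRing) (V := R_NormedModule) l)|].
  intros x0 Hx0.
  (* [filterdiff] asks for the estimate at every limit [x0] of the filter. Since [x] itself lies in
     [a, b], every ball around such an [x0] contains [x]. *)
  assert (x0 = x) as ->.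
  { apply eq_close. intros eps.
    destruct (Hx0 (ball x0 eps) (locally_ball x0 eps)) as [delta Hd].
    apply Hd; [apply ball_center|assumption]. }
  intros eps. destruct (H eps (cond_pos eps)) as [delta [Hd Hy]].
  exists (mkposreal delta Hd). intros y Hball HI. apply (Hy y HI Hball).
Qed.

Lemma continuous_on_Icc_intro (a b : R) (f : R -> R) :
  (forall x, a <= x <= b -> forall eps, 0 < eps -> exists delta, 0 < delta /\
     forall y, a <= y <= b -> Rabs (y - x) < delta -> Rabs (f y - f x) < eps) ->
  continuous_on (Icc a b) f.
Proof.
  intros H x Hx. apply filterlim_locally. intros eps.
  destruct (H x Hx eps (cond_pos eps)) as [delta [Hd Hy]].
  exists (mkposreal delta Hd). intros y Hball HI. apply (Hy y HI Hball).
Qed.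

Lemma is_derive_is_derive_Icc (a b : R) (f : R -> R) (x l : R) :
  a <= x <= b -> is_derive f x l -> is_derive_Icc a b f x l.
Proof.
  intros Hx [_ H]. apply is_derive_Icc_intro; [|assumption]. intros eps Heps.
  destruct (H x (fun P HP => HP) (mkposreal eps Heps)) as [delta Hd].
  exists delta. split; [apply cond_pos|]. intros y _ Hy. apply (Hd y Hy).
Qed.

(** * Behaviour at the two ends and the resulting solution *)

Lemma film_near_left_end (w dw : R -> R) (eps : R) :
  is_profile w dw -> 0 < eps ->
  exists delta, 0 < delta <= 1 / 4 /\ forall x, 0 < x < delta ->
    Rabs (film w x - x) <= eps * x /\ Rabs (dfilm w dw x - 1) < eps.
Proof.
  intros Hw Heps.
  (* The error in [dfilm] is at most [4 x + 2 e + 3 e] with [e = exp (slow x)], and both [x] and [e]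
     are kept within [eps / 10]. *)
  destruct (slow_near_left_end (eps / 10)) as [d [Hd H]]; [lra|].
  set (d' := Rmin d (eps / 10)).
  assert (Hd' : d' <= d /\ d' <= eps / 10) by (split; [apply Rmin_l|apply Rmin_r]).
  exists d'. split.
  - split; [apply Rmin_glb_lt; lra|lra].
  - intros x Hx. destruct (H x) as [Hs He]; [lra|].
    destruct (profile_at_minus_infinity w dw Hw _ Hs) as [H1 H2].
    destruct (Hw (slow x)) as (_ & _ & [_ H3] & _).
    generalize (profile_pos w dw Hw (slow x)). intros Hp.
    apply Rabs_le_between in H2.
    set (W := w (slow x)) in *. set (e := exp (slow x)) in *. set (V := dw (slow x)) in *.
    assert (HW2 : 1 - 2 * e <= W ^ 2 <= 1) by nra.
    split.
    + unfold film. fold W.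
      replace (x * (1 - 2 * x) * W ^ 2 - x) with (x * ((1 - 2 * x) * W ^ 2 - 1)) by ring.
      rewrite Rabs_mult, Rabs_pos_eq, Rmult_comm by lra.
      apply Rmult_le_compat_r; [lra|]. apply Rabs_le_between. nra.
    + unfold dfilm. fold W V.
      assert (-3 * e <= W * V <= 3 * e) by nra.
      apply Rabs_lt_between. nra.
Qed.

(** The barrier [sqrt 2 * beta] gives [w ^ 2 <= 2 / exp s], so [w] tends to 0; as [dw] is bounded,
    [w * dw] tends to 0 too. *)
Lemma film_near_right_end (w dw : R -> R) (eps : R) :
  is_profile w dw -> 0 < eps ->
  exists delta, 0 < delta <= 1 / 4 /\ forall x, 1 / 2 - delta < x < 1 / 2 ->
    Rabs (film w x) <= eps * (1 / 2 - x) /\ Rabs (dfilm w dw x) < eps.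
Proof.
  intros Hw Heps. set (m := Rmin 1 (eps / 6)).
  assert (Hm : 0 < m <= 1 /\ m <= eps / 6).
  { unfold m. split; [split; [apply Rmin_glb_lt; lra|apply Rmin_l]|apply Rmin_r]. }
  destruct (slow_near_right_end (m ^ 2 / 2)) as [d [Hd H]]; [nra|].
  exists d. split; [assumption|].
  intros x Hx. specialize (H x Hx).
  destruct (Hw (slow x)) as (_ & _ & [_ H3] & H4 & H5).
  generalize (profile_pos w dw Hw (slow x)). intros Hp.
  assert (HW2 : w (slow x) ^ 2 <= m ^ 2).
  { apply Rle_trans with ((sqrt 2 * beta (slow x)) ^ 2); [apply pow_incr; lra|].
    rewrite Rpow_mult_distr, pow2_sqrt, beta_sqr by lra.
    assert (/ (1 + exp (slow x)) <= / exp (slow x)).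
    { generalize (exp_pos (slow x)). intros. apply Rinv_le_contravar; lra. }
    lra. }
  apply Rabs_le_between in H5.
  set (W := w (slow x)) in *. set (V := dw (slow x)) in *.
  assert (HWm : W <= m) by nra.
  split.
  - unfold film. fold W. rewrite Rabs_pos_eq.
    + replace (x * (1 - 2 * x) * W ^ 2) with (2 * x * W ^ 2 * (1 / 2 - x)) by field.
      apply Rmult_le_compat_r; [lra|]. nra.
    + apply Rmult_le_pos; [nra|apply pow2_ge_0].
  - unfold dfilm. fold W V.
    assert (- (10 / 3) * m <= W * V <= 10 / 3 * m) by nra.
    assert (0 <= W ^ 2 <= m) by nra.
    apply Rabs_lt_between. nra.
Qed.

Lemma film_C1 (w dw : R -> R) :
  is_profile w dw ->
  C1_Icc 0 (1 / 2) (film w) /\ is_derive_Icc 0 (1 / 2) (film w) 0 1.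
Proof.
  intros Hw.
  (* The interior derivative is extended to the ends by its limits, 1 at 0 and 0 at 1/2. *)
  set (df := fun x => if Rle_dec x 0 then 1 else
                      if Rlt_dec x (1 / 2) then dfilm w dw x else 0).
  assert (Hdf : forall x, 0 < x < 1 / 2 -> df x = dfilm w dw x).
  { intros x Hx. unfold df. destruct Rle_dec; [lra|]. destruct Rlt_dec; [|lra]. reflexivity. }
  assert (Hdf0 : df 0 = 1) by (unfold df; destruct Rle_dec; [reflexivity|lra]).
  assert (Hdf1 : df (1 / 2) = 0).
  { unfold df. destruct Rle_dec; [lra|]. destruct Rlt_dec as [Hlt|]; [|reflexivity].
    exfalso. exact (Rlt_irrefl _ Hlt). }
  assert (Hf0 : film w 0 = 0) by (unfold film; ring).
  assert (Hf1 : film w (1 / 2) = 0) by (unfold film; field).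
  assert (Hleft : is_derive_Icc 0 (1 / 2) (film w) 0 1).
  { apply is_derive_Icc_intro; [|lra]. intros eps Heps.
    destruct (film_near_left_end w dw eps Hw Heps) as [d [Hd H]].
    exists d. split; [lra|]. intros y Hy Hyd.
    rewrite Hf0, !Rminus_0_r, Rmult_1_r in *.
    rewrite (Rabs_pos_eq y) in * by lra.
    destruct (Req_dec y 0) as [-> | Hy0].
    - rewrite Hf0, Rminus_0_r, Rabs_R0. lra.
    - apply (H y). lra. }
  split; [|assumption].
  exists df. split.
  - intros x [HxL HxR].
    destruct (Req_dec x 0) as [-> | Hx0]; [rewrite Hdf0; assumption|].
    destruct (Req_dec x (1 / 2)) as [-> | Hx1].
    + rewrite Hdf1. apply is_derive_Icc_intro; [|lra]. intros eps Heps.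
      destruct (film_near_right_end w dw eps Hw Heps) as [d [Hd H]].
      exists d. split; [lra|]. intros y Hy Hyd.
      rewrite Hf1, Rmult_0_r, !Rminus_0_r.
      rewrite (Rabs_minus_sym y) in *.
      rewrite (Rabs_pos_eq (1 / 2 - y)) in * by lra.
      destruct (Req_dec y (1 / 2)) as [-> | Hy1].
      * rewrite Hf1, Rabs_R0. lra.
      * apply (H y). lra.
    + rewrite Hdf by lra. apply is_derive_is_derive_Icc; [lra|].
      apply is_derive_film; [assumption|lra].
  - apply continuous_on_Icc_intro. intros x Hx eps Heps.
    destruct (Req_dec x 0) as [-> | Hx0]; [|destruct (Req_dec x (1 / 2)) as [-> | Hx1]].
    + destruct (film_near_left_end w dw eps Hw Heps) as [d [Hd H]].
      exists d. split; [lra|]. intros y Hy Hyd.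
      rewrite Hdf0. apply Rabs_lt_between in Hyd.
      destruct (Req_dec y 0) as [-> | Hy0].
      * rewrite Hdf0, Rminus_diag, Rabs_R0. lra.
      * rewrite Hdf by lra. apply H. lra.
    + destruct (film_near_right_end w dw eps Hw Heps) as [d [Hd H]].
      exists d. split; [lra|]. intros y Hy Hyd.
      rewrite Hdf1, Rminus_0_r. apply Rabs_lt_between in Hyd.
      destruct (Req_dec y (1 / 2)) as [-> | Hy1].
      * rewrite Hdf1, Rabs_R0. lra.
      * rewrite Hdf by lra. apply H. lra.
    + assert (Hc : continuous (dfilm w dw) x).
      { apply (ex_derive_continuous (dfilm w dw)). exists (ddfilm w dw x).
        apply is_derive_dfilm; [assumption|lra]. }
      assert (Hc' : continuous df x).
      { apply (continuous_ext_loc _ (dfilm w dw)); [|assumption].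
        apply (locally_Ioo _ 0 (1 / 2)); [lra|]. intros y Hy. now rewrite Hdf. }
      destruct (proj1 (filterlim_locally df (df x)) Hc' (mkposreal eps Heps)) as [d Hd].
      exists d. split; [apply cond_pos|]. intros y _ Hy. apply (Hd y Hy).
Qed.

Lemma film_is_solution (w dw : R -> R) : is_profile w dw -> is_solution (1 / 2) (film w).
Proof.
  intros Hw. destruct (film_C1 w dw Hw) as [HC1 H0].
  destruct (Cn_Ioo_3_intro 0 (1 / 2) (film w) (dfilm w dw) (ddfilm w dw) (fun x => / film w x))
    as [HC3 HD].
  - intros x. now apply is_derive_film.
  - intros x. now apply is_derive_dfilm.
  - intros x. now apply is_derive_ddfilm.
  - intros x Hx. apply (continuous_comp (film w) Rinv).
    + apply (ex_derive_continuous (film w)). exists (dfilm w dw x). now apply is_derive_film.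
    + apply continuous_Rinv. generalize (film_pos w dw x Hw Hx). lra.
  - split; [assumption|]. split; [assumption|]. split; [|split; [|split; [|split]]].
    + intros x Hx. now apply (film_pos w dw).
    + intros x Hx. rewrite HD by assumption. apply Rinv_r.
      generalize (film_pos w dw x Hw Hx). lra.
    + unfold film. ring.
    + unfold film. field.
    + assumption.
Qed.

(** * Uniqueness *)

Lemma is_derive_Icc_elim (a b : R) (f : R -> R) (x l eps : R) :
  is_derive_Icc a b f x l -> 0 < eps -> exists delta, 0 < delta /\
     forall y, a <= y <= b -> Rabs (y - x) < delta ->
     Rabs (f y - f x - (y - x) * l) <= eps * Rabs (y - x).
Proof.
  intros [_ H] Heps.
  destruct (H x (filter_le_within (F := locally x) (Icc a b)) (mkposreal eps Heps)) as [delta Hd].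
  exists delta. split; [apply cond_pos|]. intros y HI Hy. apply (Hd y Hy HI).
Qed.

Lemma continuous_on_Icc_elim (a b : R) (f : R -> R) (x eps : R) :
  continuous_on (Icc a b) f -> a <= x <= b -> 0 < eps -> exists delta, 0 < delta /\
     forall y, a <= y <= b -> Rabs (y - x) < delta -> Rabs (f y - f x) < eps.
Proof.
  intros H Hx Heps.
  destruct (proj1 (filterlim_locally f (f x)) (H x Hx) (mkposreal eps Heps)) as [delta Hd].
  exists delta. split; [apply cond_pos|]. intros y HI Hy. apply (Hd y Hy HI).
Qed.

Lemma Icc_point_nearby (a b x delta : R) :
  a < b -> a <= x <= b -> 0 < delta ->
  exists y, a <= y <= b /\ 0 < Rabs (y - x) < delta.
Proof.
  intros Hab Hx Hd.
  destruct (Rlt_dec x b) as [Hxb | Hxb].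
  - set (h := Rmin (delta / 2) (b - x)).
    assert (Hh : 0 < h /\ h <= delta / 2 /\ h <= b - x).
    { split; [apply Rmin_glb_lt; lra|split; [apply Rmin_l|apply Rmin_r]]. }
    exists (x + h). rewrite Rabs_pos_eq; lra.
  - set (h := Rmin (delta / 2) (b - a)).
    assert (Hh : 0 < h /\ h <= delta / 2 /\ h <= b - a).
    { split; [apply Rmin_glb_lt; lra|split; [apply Rmin_l|apply Rmin_r]]. }
    exists (x - h). rewrite Rabs_left; lra.
Qed.

Lemma is_derive_Icc_unique (a b : R) (f : R -> R) (x l1 l2 : R) :
  a < b -> a <= x <= b -> is_derive_Icc a b f x l1 -> is_derive_Icc a b f x l2 -> l1 = l2.
Proof.
  intros Hab Hx H1 H2. destruct (Req_dec l1 l2) as [|Hne]; [assumption|exfalso].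
  set (eps := Rabs (l1 - l2) / 4).
  assert (Heps : 0 < eps) by (generalize (Rabs_pos_lt (l1 - l2)); unfold eps; lra).
  destruct (is_derive_Icc_elim _ _ _ _ _ _ H1 Heps) as [d1 [Hd1 K1]].
  destruct (is_derive_Icc_elim _ _ _ _ _ _ H2 Heps) as [d2 [Hd2 K2]].
  destruct (Icc_point_nearby a b x (Rmin d1 d2) Hab Hx) as [y [Hy Hyx]].
  { apply Rmin_glb_lt; assumption. }
  specialize (K1 y Hy (Rlt_le_trans _ _ _ (proj2 Hyx) (Rmin_l _ _))).
  specialize (K2 y Hy (Rlt_le_trans _ _ _ (proj2 Hyx) (Rmin_r _ _))).
  assert (H : Rabs (y - x) * Rabs (l1 - l2) <= 2 * eps * Rabs (y - x)).
  { rewrite <- Rabs_mult.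
    apply Rabs_le_between in K1, K2. apply Rabs_le_between. lra. }
  unfold eps in H, Heps. nra.
Qed.

(** Composition with this projection turns continuity relative to [a, b] into continuity on the
    line, the form in which the extreme value theorem is applied. *)
Definition clamp (a b x : R) : R := Rmax a (Rmin b x).

Lemma clamp_Icc (a b x : R) : a <= b -> a <= clamp a b x <= b.
Proof.
  intros H. split; [apply Rmax_l|]. apply Rmax_lub; [assumption|apply Rmin_l].
Qed.

Lemma clamp_id (a b x : R) : a <= x <= b -> clamp a b x = x.
Proof. intros H. unfold clamp. rewrite Rmin_right, Rmax_right; lra. Qed.

Lemma clamp_nonexpansive (a b x y : R) : Rabs (clamp a b x - clamp a b y) <= Rabs (x - y).
Proof.
  unfold clamp, Rmax, Rmin.
  repeat destruct Rle_dec; apply Rabs_le_between; unfold Rabs; destruct Rcase_abs; lra.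
Qed.

Lemma continuous_on_Icc_clamp (a b : R) (f : R -> R) :
  a <= b -> continuous_on (Icc a b) f -> forall x, continuous (fun y => f (clamp a b y)) x.
Proof.
  intros Hab Hf x.
  apply (filterlim_comp _ _ _ (clamp a b) f (locally x)
           (within (Icc a b) (locally (clamp a b x)))).
  - intros P [eps HP]. exists eps. intros y Hy.
    apply HP; [|now apply clamp_Icc].
    eapply Rle_lt_trans; [apply clamp_nonexpansive|exact Hy].
  - apply Hf. now apply clamp_Icc.
Qed.

Lemma C1_Icc_continuous_on (a b : R) (f : R -> R) :
  C1_Icc a b f -> continuous_on (Icc a b) f.
Proof.
  intros [f' [Hf _]]. apply continuous_on_Icc_intro. intros x Hx eps Heps.
  destruct (is_derive_Icc_elim _ _ _ _ _ 1 (Hf x Hx) Rlt_0_1) as [d [Hd H]].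
  generalize (Rabs_pos (f' x)). intros Hl.
  assert (He : 0 < eps / (2 + Rabs (f' x))) by (apply Rdiv_lt_0_compat; lra).
  exists (Rmin d (eps / (2 + Rabs (f' x)))). split; [now apply Rmin_glb_lt|].
  intros y Hy Hyx.
  assert (H1 := Rlt_le_trans _ _ _ Hyx (Rmin_l _ _)).
  assert (H2 := Rlt_le_trans _ _ _ Hyx (Rmin_r _ _)).
  apply Rlt_div_r in H2; [|lra].
  replace (f y - f x) with ((f y - f x - (y - x) * f' x) + (y - x) * f' x) by ring.
  eapply Rle_lt_trans; [apply Rabs_triang|]. rewrite Rabs_mult.
  generalize (H y Hy H1) (Rabs_pos (y - x)). intros. nra.
Qed.

(** Since [df] vanishes at [x], a positive [l] would make [df] positive just to the right of [x],
    and [f] would exceed its maximum. *)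
Lemma second_derivative_at_max (a b x l : R) (f df : R -> R) :
  a < x < b -> (forall y, a < y < b -> is_derive f y (df y)) ->
  is_derive df x l -> (forall y, a < y < b -> f y <= f x) -> l <= 0.
Proof.
  intros Hx Hf Hl Hmax.
  assert (H0 : df x = 0).
  { assert (D : derivable_pt_lim f x (df x)) by (apply is_derive_Reals, Hf, Hx).
    rewrite <- (derive_pt_eq_0 f x (df x) (exist _ (df x) D) D).
    apply (deriv_maximum f a b); try apply Hx. intros y H1 H2. apply Hmax. now split. }
  apply Rnot_lt_le. intros Hpos.
  destruct Hl as [_ Hl].
  destruct (Hl x (fun P HP => HP) (mkposreal (l / 2) ltac:(lra))) as [delta Hd].
  set (h := Rmin (delta / 2) ((b - x) / 2)).
  assert (Hh : 0 < h /\ h <= delta / 2 /\ h <= (b - x) / 2).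
  { generalize (cond_pos delta). intros.
    split; [apply Rmin_glb_lt; lra|split; [apply Rmin_l|apply Rmin_r]]. }
  assert (Hincr : forall y, x < y <= x + h -> 0 < df y).
  { intros y Hy. assert (Hyx : Rabs (y - x) < delta) by (rewrite Rabs_pos_eq; lra).
    specialize (Hd y Hyx). change (Rabs (df y - df x - (y - x) * l) <= l / 2 * Rabs (y - x)) in Hd.
    rewrite H0, (Rabs_pos_eq (y - x)) in Hd by lra.
    apply Rabs_le_between in Hd. nra. }
  destruct (mvt f df x (x + h)) as [c [Hc E]]; [lra|intros; apply Hf; lra|].
  (* The right half of the interval stays away from the zero [x] of [df], which makes this increase
     strict. *)
  destruct (mvt f df (x + h / 2) (x + h)) as [e [He E2]]; [lra|intros; apply Hf; lra|].
  assert (H1 : f x <= f (x + h / 2)).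
  { apply (nondecreasing_of_derive f df); [lra|intros; apply Hf; lra|].
    intros y Hy. destruct (Req_dec y x) as [-> | Hyx]; [lra|].
    left. apply Hincr. lra. }
  generalize (Hincr e ltac:(lra)) (Hmax (x + h) ltac:(lra)). nra.
Qed.

(** The difference [f - kappa * ln] is nondecreasing, while [ln] tends to -oo at 0. *)
Lemma inverse_derivative_unbounded (f df : R -> R) (delta kappa M : R) :
  0 < delta -> 0 < kappa ->
  (forall x, 0 < x < delta -> is_derive f x (df x)) ->
  (forall x, 0 < x < delta -> kappa / x <= df x) ->
  (forall x, 0 < x < delta -> Rabs (f x) <= M) -> False.
Proof.
  intros Hd Hk Hf Hdf HM.
  (* From [y] down to [y * exp (- T)] the function drops by at least [kappa * T = 2 * M + 1], more
     than the bound [M] allows. *)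
  set (y := delta / 2). set (T := (2 * M + 1) / kappa).
  assert (HM0 : 0 <= M).
  { generalize (HM y) (Rabs_pos (f y)). unfold y. intros H1 H2. specialize (H1 ltac:(lra)). lra. }
  assert (HT : 0 < T) by (apply Rdiv_lt_0_compat; lra).
  assert (HkT : kappa * T = 2 * M + 1) by (unfold T; field; lra).
  set (x := y * exp (- T)).
  assert (He : 0 < exp (- T) < 1).
  { split; [apply exp_pos|]. rewrite <- exp_0. apply exp_increasing. lra. }
  assert (Hy : 0 < y < delta) by (unfold y; lra).
  assert (Hx : 0 < x < y) by (unfold x; nra).
  assert (Hln : ln x = ln y - T).
  { unfold x. rewrite ln_mult, ln_exp by lra. ring. }
  assert (H : f x - kappa * ln x <= f y - kappa * ln y).
  { apply (nondecreasing_of_derive (fun z => f z - kappa * ln z) (fun z => df z - kappa / z));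
      [lra| |].
    - intros z Hz. apply (is_derive_minus f (fun z => kappa * ln z)); [apply Hf; lra|].
      auto_derive; [lra|]. field. lra.
    - intros z Hz. generalize (Hdf z ltac:(lra)). lra. }
  generalize (HM x ltac:(lra)) (HM y Hy). intros H1 H2.
  apply Rabs_le_between in H1, H2. rewrite Hln in H. lra.
Qed.

(** * The energy identity and the equation for the square root *)

Lemma solution_derivatives (d : R) (psi : R -> R) :
  is_solution d psi -> forall x, 0 < x < d ->
  is_derive psi x (Derive_n psi 1 x) /\
  is_derive (Derive_n psi 1) x (Derive_n psi 2 x) /\
  is_derive (Derive_n psi 2) x (/ psi x).
Proof.
  intros (HC & _ & Hpos & Heq & _) x Hx.
  split; [|split].
  - apply Derive_correct, (HC x Hx 1%nat). lia.
  - apply Derive_correct, (HC x Hx 2%nat). lia.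
  - replace (/ psi x) with (Derive_n psi 3 x).
    + apply Derive_correct, (HC x Hx 3%nat). lia.
    + generalize (Hpos x Hx) (Heq x Hx). intros H1 H2.
      apply (Rmult_eq_reg_l (psi x)); [|lra]. rewrite H2. field. lra.
Qed.

(** The continuous derivative on [0, d] equals 1 at 0 and agrees with [Derive_n psi 1] inside, both
    by uniqueness of the derivative on [0, d]. *)
Lemma solution_near_left_end (d eps : R) (psi : R -> R) :
  0 < d -> is_solution d psi -> 0 < eps ->
  exists delta, 0 < delta <= d /\ forall x, 0 < x < delta ->
    psi x <= (1 + eps) * x /\ Rabs (Derive_n psi 1 x - 1) < eps.
Proof.
  intros Hd Hpsi Heps. assert (Hder := solution_derivatives d psi Hpsi).
  destruct Hpsi as (_ & [f' [Hf' Hcont]] & _ & _ & Hpsi0 & _ & Hder0).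
  assert (E0 : f' 0 = 1).
  { apply (is_derive_Icc_unique 0 d psi 0); try assumption; [lra|]. apply Hf'. unfold Icc. lra. }
  destruct (is_derive_Icc_elim _ _ _ _ _ _ Hder0 Heps) as [d1 [Hd1 H1]].
  destruct (continuous_on_Icc_elim _ _ _ 0 _ Hcont ltac:(lra) Heps) as [d2 [Hd2 H2]].
  set (delta := Rmin d (Rmin d1 d2)).
  assert (Hdelta : delta <= d /\ delta <= d1 /\ delta <= d2).
  { split; [apply Rmin_l|]. split; (eapply Rle_trans; [apply Rmin_r|]); [apply Rmin_l|apply Rmin_r]. }
  exists delta. split.
  - split; [repeat apply Rmin_glb_lt; assumption|lra].
  - intros x Hx.
    assert (Hx0 : Rabs (x - 0) = x) by (rewrite Rminus_0_r, Rabs_pos_eq; lra).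
    split.
    + specialize (H1 x ltac:(lra) ltac:(lra)). rewrite Hx0, Hpsi0 in H1.
      apply Rabs_le_between in H1. lra.
    + specialize (H2 x ltac:(lra) ltac:(lra)). rewrite E0 in H2.
      replace (Derive_n psi 1 x) with (f' x); [assumption|].
      apply (is_derive_Icc_unique 0 d psi x); [lra|lra| |].
      * apply Hf'. unfold Icc. lra.
      * apply is_derive_is_derive_Icc; [lra|]. apply Hder. lra.
Qed.

(* [psi psi'' - psi' ^ 2 / 2 - x] is a constant [c], so [psi psi'' -> c + 1 / 2] at [0];
   a nonzero limit would give [psi'' ~ (c + 1 / 2) / x] and an unbounded [psi']. *)
Lemma solution_energy (d : R) (psi : R -> R) :
  0 < d -> is_solution d psi -> forall x, 0 < x < d ->
  psi x * Derive_n psi 2 x - Derive_n psi 1 x ^ 2 / 2 = x - 1 / 2.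
Proof.
  intros Hd Hpsi. assert (Hder := solution_derivatives d psi Hpsi).
  set (D1 := Derive_n psi 1) in *. set (D2 := Derive_n psi 2) in *.
  set (E := fun x => psi x * D2 x - D1 x ^ 2 / 2).
  assert (Hpos : forall x, 0 < x < d -> 0 < psi x) by apply Hpsi.
  assert (HE : forall x, 0 < x < d -> is_derive E x 1).
  { intros x Hx. destruct (Hder x Hx) as (H0 & H1 & H2).
    assert (E0 := is_derive_unique _ _ _ H0).
    assert (E1 := is_derive_unique _ _ _ H1).
    assert (E2 := is_derive_unique _ _ _ H2).
    unfold E. auto_derive.
    - repeat split; eexists; eassumption.
    - change (Derive (fun x => psi x) x) with (Derive psi x).
      change (Derive (fun x => D1 x) x) with (Derive D1 x).
      change (Derive (fun x => D2 x) x) with (Derive D2 x).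
      rewrite E0, E1, E2. field. generalize (Hpos x Hx). lra. }
  assert (Hslope : forall x y, 0 < x -> x < y -> y < d -> E y - E x = y - x).
  { intros x y Hx Hxy Hy. destruct (mvt E (fun _ => 1) x y) as [c [_ Hc]]; [lra| |lra].
    intros z Hz. apply HE. lra. }
  set (k := E (d / 2) - d / 2 + 1 / 2).
  assert (Hk : forall x, 0 < x < d -> E x = x - 1 / 2 + k).
  { intros x Hx. unfold k. destruct (Rtotal_order x (d / 2)) as [H | [-> | H]].
    - generalize (Hslope x (d / 2)). lra.
    - ring.
    - generalize (Hslope (d / 2) x). lra. }
  assert (Hk0 : k = 0).
  { destruct (Req_dec k 0) as [|Hne]; [assumption|exfalso].
    (* Here [psi psi'' - k = x + (psi' ^ 2 - 1) / 2], at most [x + 3 eps / 2] in modulus; the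
       choices of [eps] and [delta] keep this below [Rabs k / 2]. *)
    set (eps := Rmin 1 (Rabs k / 8)).
    assert (Hk1 : 0 < Rabs k) by now apply Rabs_pos_lt.
    assert (Heps : 0 < eps <= 1 /\ eps <= Rabs k / 8).
    { split; [split; [apply Rmin_glb_lt; lra|apply Rmin_l]|apply Rmin_r]. }
    destruct (solution_near_left_end d eps psi Hd Hpsi) as [d0 [Hd0 Hnear]]; [lra|].
    fold D1 in Hnear.
    set (delta := Rmin d0 (Rabs k / 8)).
    assert (Hdelta : delta <= d0 /\ delta <= Rabs k / 8) by (split; [apply Rmin_l|apply Rmin_r]).
    assert (Hdelta0 : 0 < delta) by (apply Rmin_glb_lt; lra).
    assert (Hprod : forall x, 0 < x < delta ->
              Rabs (psi x * D2 x - k) <= Rabs k / 2 /\ psi x <= 2 * x /\ Rabs (D1 x) <= 2).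
    { intros x Hx. destruct (Hnear x) as [H1 H2]; [lra|].
      assert (H3 := Hk x ltac:(lra)). unfold E in H3.
      apply Rabs_lt_between in H2.
      split; [|split]; [apply Rabs_le_between; nra|nra|apply Rabs_le_between; lra]. }
    assert (Hinv : forall x, 0 < x < delta -> / (2 * x) <= / psi x).
    { intros x Hx. apply Rinv_le_contravar; [apply Hpos; lra|apply Hprod; assumption]. }
    assert (Hquot : forall x, 0 < x < delta -> D2 x = psi x * D2 x * / psi x).
    { intros x Hx. field. generalize (Hpos x ltac:(lra)). lra. }
    assert (Hquarter : forall x, 0 < x < delta -> Rabs k / 4 / x = Rabs k / 2 * / (2 * x)).
    { intros x Hx. field. lra. }
    (* Together with [psi <= 2 x], this bounds [psi''] in modulus from below by [Rabs k / (4 x)],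
       with the sign of [k]; a negative [k] is treated through [- psi']. *)
    destruct (Rlt_or_le 0 k) as [Hkp | Hkn].
    - apply (inverse_derivative_unbounded D1 D2 delta (Rabs k / 4) 2); [lra|lra| | |].
      + intros x Hx. apply Hder. lra.
      + intros x Hx. rewrite Hquarter, Hquot by assumption.
        destruct (Hprod x Hx) as (H1 & _ & _). apply Rabs_le_between in H1.
        rewrite (Rabs_pos_eq k) in * by lra.
        apply Rmult_le_compat; [lra| |lra|apply Hinv; assumption].
        left. apply Rinv_0_lt_compat. lra.
      + intros x Hx. apply Hprod. assumption.
    - apply (inverse_derivative_unbounded (fun x => - D1 x) (fun x => - D2 x)
               delta (Rabs k / 4) 2); [lra|lra| | |].
      + intros x Hx. apply (is_derive_opp D1). apply Hder. lra.
      + intros x Hx. rewrite Hquarter, Hquot by assumption.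
        destruct (Hprod x Hx) as (H1 & _ & _). apply Rabs_le_between in H1.
        rewrite (Rabs_left1 k) in * by lra.
        rewrite Ropp_mult_distr_l.
        apply Rmult_le_compat; [lra| |lra|apply Hinv; assumption].
        left. apply Rinv_0_lt_compat. lra.
      + intros x Hx. rewrite Rabs_Ropp. apply Hprod. assumption. }
  intros x Hx. change (E x = x - 1 / 2). rewrite Hk by assumption. lra.
Qed.

(** For [u = sqrt psi] one computes [4 u ^ 3 u'' = 2 psi psi'' - psi' ^ 2], which is [2 x - 1] by
    the energy identity. *)
Lemma solution_sqrt (d : R) (psi : R -> R) :
  0 < d -> is_solution d psi ->
  exists du : R -> R, forall x, 0 < x < d ->
    is_derive (fun x => sqrt (psi x)) x (du x) /\
    is_derive du x (- ((1 - 2 * x) / 4) * / sqrt (psi x) ^ 3).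
Proof.
  intros Hd Hpsi.
  exists (fun x => Derive_n psi 1 x / (2 * sqrt (psi x))). intros x Hx.
  destruct (solution_derivatives d psi Hpsi x Hx) as (H0 & H1 & _).
  assert (HE := solution_energy d psi Hd Hpsi x Hx).
  set (D1 := Derive_n psi 1) in *. set (D2 := Derive_n psi 2) in *.
  assert (Hpos : 0 < psi x) by (apply Hpsi; assumption).
  assert (Hs : 0 < sqrt (psi x)) by (now apply sqrt_lt_R0).
  assert (Hs2 : sqrt (psi x) ^ 2 = psi x) by (apply pow2_sqrt; lra).
  assert (E0 := is_derive_unique _ _ _ H0).
  assert (E1 := is_derive_unique _ _ _ H1).
  split.
  - auto_derive.
    + split; [eexists; eassumption|]. split; [assumption|trivial].
    + change (Derive (fun x => psi x) x) with (Derive psi x). rewrite E0. field. lra.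
  - auto_derive.
    + repeat split; try (eexists; eassumption); lra.
    + change (Derive (fun x => psi x) x) with (Derive psi x).
      change (Derive (fun x => D1 x) x) with (Derive D1 x).
      rewrite E0, E1.
      set (u := sqrt (psi x)) in *.
      assert (HD2 : D2 x = (D1 x ^ 2 / 2 + x - 1 / 2) / u ^ 2).
      { rewrite Hs2. apply (Rmult_eq_reg_l (psi x)); [|lra].
        replace (psi x * D2 x) with (D1 x ^ 2 / 2 + x - 1 / 2) by lra. field. lra. }
      rewrite HD2. field. lra.
Qed.

(** At a positive interior maximum of [sqrt psi - sqrt phi] the second derivative would be positive,
    because [- (1 - 2 x) / (4 u ^ 3)] is strictly increasing in [u > 0] for [x < 1 / 2]. Exchanging
    the two solutions gives equality. *)
Lemma solution_le (psi phi : R -> R) :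
  is_solution (1 / 2) psi -> is_solution (1 / 2) phi ->
  forall x, 0 <= x <= 1 / 2 -> psi x <= phi x.
Proof.
  intros Hpsi Hphi.
  set (G := fun x => sqrt (psi x) - sqrt (phi x)).
  assert (Hcont : forall f, is_solution (1 / 2) f -> forall x,
            continuous (fun y => sqrt (f (clamp 0 (1 / 2) y))) x).
  { intros f Hf x.
    apply (continuous_comp (fun y => f (clamp 0 (1 / 2) y)) sqrt).
    - apply (continuous_on_Icc_clamp 0 (1 / 2) f); [lra|].
      apply C1_Icc_continuous_on, Hf.
    - apply continuity_pt_filterlim, continuity_pt_sqrt.
      destruct Hf as (_ & _ & Hpos & _ & H0 & H1 & _).
      generalize (clamp_Icc 0 (1 / 2) x ltac:(lra)). intros Hc.
      set (c := clamp 0 (1 / 2) x) in *.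
      destruct (Req_dec c 0) as [-> | Hc0]; [lra|].
      destruct (Req_dec c (1 / 2)) as [-> | Hc1]; [lra|].
      left. apply Hpos. lra. }
  destruct (continuity_ab_maj (fun y => G (clamp 0 (1 / 2) y)) 0 (1 / 2)) as [m [Hmax Hm]].
  { lra. }
  { intros c _. apply continuity_pt_filterlim.
    apply (continuous_minus (fun y => sqrt (psi (clamp 0 (1 / 2) y)))
             (fun y => sqrt (phi (clamp 0 (1 / 2) y)))); auto. }
  assert (HGmax : forall x, 0 <= x <= 1 / 2 -> G x <= G m).
  { intros x Hx. generalize (Hmax x Hx). cbv beta. now rewrite !clamp_id. }
  assert (HGm : G m <= 0).
  { apply Rnot_lt_le. intros Hlt.
    assert (Hm0 : m <> 0).
    { intros ->. revert Hlt. unfold G. destruct Hpsi as (_ & _ & _ & _ & -> & _).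
      destruct Hphi as (_ & _ & _ & _ & -> & _). lra. }
    assert (Hm1 : m <> 1 / 2).
    { intros ->. revert Hlt. unfold G. destruct Hpsi as (_ & _ & _ & _ & _ & -> & _).
      destruct Hphi as (_ & _ & _ & _ & _ & -> & _). lra. }
    assert (Hmi : 0 < m < 1 / 2) by lra.
    destruct (solution_sqrt (1 / 2) psi ltac:(lra) Hpsi) as [du Hu].
    destruct (solution_sqrt (1 / 2) phi ltac:(lra) Hphi) as [dv Hv].
    assert (H := second_derivative_at_max 0 (1 / 2) m
      (- ((1 - 2 * m) / 4) * / sqrt (psi m) ^ 3 - - ((1 - 2 * m) / 4) * / sqrt (phi m) ^ 3)
      G (fun x => du x - dv x) Hmi).
    assert (Hle : - ((1 - 2 * m) / 4) * / sqrt (psi m) ^ 3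
                  - - ((1 - 2 * m) / 4) * / sqrt (phi m) ^ 3 <= 0).
    { apply H.
      - intros y Hy. apply (is_derive_minus (fun x => sqrt (psi x)) (fun x => sqrt (phi x)));
          [apply Hu|apply Hv]; assumption.
      - apply (is_derive_minus du dv); [apply Hu|apply Hv]; assumption.
      - intros y Hy. apply HGmax. lra. }
    assert (Hv0 : 0 < sqrt (phi m)) by (apply sqrt_lt_R0, Hphi, Hmi).
    assert (Huv : sqrt (phi m) < sqrt (psi m)) by (unfold G in Hlt; lra).
    assert (Hinv : / sqrt (psi m) ^ 3 < / sqrt (phi m) ^ 3).
    { apply Rinv_lt_contravar.
      - apply Rmult_lt_0_compat; apply pow_lt; lra.
      - assert (sqrt (phi m) ^ 2 < sqrt (psi m) ^ 2) by nra. nra. }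
    nra. }
  intros x Hx. destruct (Req_dec x 0) as [-> | Hx0].
  { destruct Hpsi as (_ & _ & _ & _ & -> & _). destruct Hphi as (_ & _ & _ & _ & -> & _). lra. }
  destruct (Req_dec x (1 / 2)) as [-> | Hx1].
  { destruct Hpsi as (_ & _ & _ & _ & _ & -> & _).
    destruct Hphi as (_ & _ & _ & _ & _ & -> & _). lra. }
  apply sqrt_le_0; [left; apply Hpsi; lra|left; apply Hphi; lra|].
  generalize (HGmax x Hx). unfold G in *. lra.
Qed.

(* Functions on [0, d] are represented by total functions on R; uniqueness is
   therefore equality on [0, d]. *)
Theorem theorem1 :
  let d := 1 / 2 in
  exists phi : R -> R,
    is_solution d phi /\
    forall psi : R -> R, is_solution d psi ->
      forall eta : R, 0 <= eta <= d -> psi eta = phi eta.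
Proof.
  intros d. destruct profile_exists as [w [dw Hw]].
  assert (Hphi := film_is_solution w dw Hw).
  exists (film w). split; [exact Hphi|]. intros psi Hpsi eta Heta.
  apply Rle_antisym; now apply solution_le.
Qed.
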